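(* The ideals associated to series-parallel networks (series-parallel ideals) are Mayer-Vietoris ideals of type $A$.
   Context: $\mathbf{k}$ is a field of characteristic $0$. Networks: a network $N$ has an input node, an output node and labelled edges $p_1,\dots,p_n$ (connections). Given networks $N_1,N_2$, with edges relabelled so that all labels are distinct, the series union $N_1+N_2$ identifies the output node of $N_1$ with the input node of $N_2$, and has as input the input of $N_1$ and as output the output of $N_2$; the parallel union $N_1\times N_2$ identifies the two input nodes (which become the input) and the two output nodes (which become the output). A network is series-parallel if it consists of an input node, an output node and a single edge joining them, or if it is $N_1+N_2$ or $N_1\times N_2$ with $N_1,N_2$ series-parallel networks. Ideal of a network: taking one variable for each edge of $N$, the ideal $I_N$ is the monomial ideal minimally generated by the monomials $\prod_{s\in S}x_s$ where $S$ runs over the minimal cuts of $N$ (minimal sets of edges whose removal disconnects the input from the output). In particular a one-edge network has ideal $\langle x_1\rangle$. Mayer-Vietoris trees: a Mayer-Vietoris tree $MVT(I)$ of a nonzero monomial ideal $I$ is a rooted binary tree whose nodes are (labelled by) monomial ideals, with root $I$. Whenever a node $J$ has minimal monomial generating set $\{m_1,\dots,m_s\}$ with $s\geq 2$, one minimal generator (the pivot monomial) is chosen, the choice being arbitrary at each node; numbering so that the pivot is $m_s$, the node $J$ has exactly two children: the left child $\tilde J=\langle m_1,\dots,m_{s-1}\rangle\cap\langle m_s\rangle=\langle \mathrm{lcm}(m_1,m_s),\dots,\mathrm{lcm}(m_{s-1},m_s)\rangle$ and the right child $J'=\langle m_1,\dots,m_{s-1}\rangle$. Nodes with a single minimal generator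 are leaves. Positions: the root has position $1$; left and right children of the node in position $p$ have positions $2p$ and $2p+1$. A node is relevant if its position is $1$ or even. Type $A$: $I$ is a Mayer-Vietoris ideal of type $A$ if there exists a Mayer-Vietoris tree of $I$ with no repeated generator in the ideals of the relevant nodes, i.e. no monomial is a minimal generator of two different relevant nodes. *)

(* Defs.v *)
From HB Require Import structures.
From mathcomp Require Import all_boot all_order all_algebra.
From mathcomp Require Import finmap mpoly.

Set Implicit Arguments.
Unset Strict Implicit.
Unset Printing Implicit Defensive.

Import GRing.Theory.
Local Open Scope ring_scope.

(* A network with n edges labelled by 'I_n: an undirected multigraph with two
   distinguished distinct nodes. The pair [ends e] lists the two end nodes of
   e; its order carries no meaning. *)
Record network (n : nat) := Network {
  node : finType;
  input : node;
  output : node;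
  ends : 'I_n -> node * node;
  input_neq_output : input != output }.

Definition joins n (N : network n) (e : 'I_n) (u v : node N) : bool :=
  (ends N e == (u, v)) || (ends N e == (v, u)).
Arguments joins {n} N e u v.

Definition one_edge : network 1 :=
  @Network 1 bool false true (fun=> (false, true)) isT.

(* Both unions relabel the edges by the standard bijection between 'I_(n1 + n2)
   and the disjoint union of 'I_n1 and 'I_n2; [split] is its inverse. *)
Definition glue_ends n1 n2 (T1 T2 T : Type) (i1 : T1 -> T) (i2 : T2 -> T)
    (f1 : 'I_n1 -> T1 * T1) (f2 : 'I_n2 -> T2 * T2) (e : 'I_(n1 + n2)) : T * T :=
  match split e with
  | inl e1 => (i1 (f1 e1).1, i1 (f1 e1).2)
  | inr e2 => (i2 (f2 e2).1, i2 (f2 e2).2)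
  end.

Section Unions.
Variables (n1 n2 : nat) (N1 : network n1) (N2 : network n2).

(* The gluings are the disjoint unions of the nodes of N1 with those nodes of
   N2 that are not identified with a node of N1. *)

Definition series_node : finType :=
  (node N1 + {v : node N2 | v != input N2})%type.

Definition series_inl (v : node N1) : series_node := inl v.

Definition series_inr (v : node N2) : series_node :=
  if insub v is Some w then inr w else inl (output N1).

Fact series_neq : series_inl (input N1) != series_inr (output N2).
Proof. by rewrite /series_inr insubT 1?eq_sym ?input_neq_output. Qed.

Definition series_union : network (n1 + n2) :=
  @Network (n1 + n2) series_node
    (series_inl (input N1)) (series_inr (output N2))
    (glue_ends series_inl series_inr (ends N1) (ends N2)) series_neq.

Definition parallel_node : finType :=
  (node N1 + {v : node N2 | (v != input N2) && (v != output N2)})%type.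

Definition parallel_inl (v : node N1) : parallel_node := inl v.

Definition parallel_inr (v : node N2) : parallel_node :=
  if insub v is Some w then inr w
  else if v == input N2 then inl (input N1) else inl (output N1).

Fact parallel_neq : parallel_inl (input N1) != parallel_inl (output N1).
Proof. exact: input_neq_output. Qed.

Definition parallel_union : network (n1 + n2) :=
  @Network (n1 + n2) parallel_node
    (parallel_inl (input N1)) (parallel_inl (output N1))
    (glue_ends parallel_inl parallel_inr (ends N1) (ends N2)) parallel_neq.

End Unions.

Definition network_iso n (N N' : network n) : Prop :=
  exists (f : node N -> node N') (g : 'I_n -> 'I_n),
    [/\ bijective f, bijective g, f (input N) = input N',
        f (output N) = output N' &
        forall e u v, joins N' (g e) (f u) (f v) = joins N e u v].

(* [sp_iso] makes the class independent of the names of the nodes and of the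
   labelling of the edges, both of which the unions above choose arbitrarily. *)
Inductive series_parallel : forall n, network n -> Prop :=
| sp_edge : series_parallel one_edge
| sp_series n1 n2 (N1 : network n1) (N2 : network n2) :
    series_parallel N1 -> series_parallel N2 ->
    series_parallel (series_union N1 N2)
| sp_parallel n1 n2 (N1 : network n1) (N2 : network n2) :
    series_parallel N1 -> series_parallel N2 ->
    series_parallel (parallel_union N1 N2)
| sp_iso n (N N' : network n) :
    network_iso N N' -> series_parallel N -> series_parallel N'.

Definition is_cut n (N : network n) (S : {set 'I_n}) : bool :=
  ~~ connect [rel u v | [exists e, (e \notin S) && joins N e u v]]
       (input N) (output N).

Definition is_minimal_cut n (N : network n) (S : {set 'I_n}) : bool :=
  minset (is_cut N) S.

Section Ideals.
Variables (k : fieldType) (n : nat).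

(* Ideals are subsets of the polynomial ring, compared by [same_ideal]. *)
Definition ideal := {mpoly k[n]} -> Prop.

Definition same_ideal (I J : ideal) : Prop := forall p, I p <-> J p.

Definition ideal_cap (I J : ideal) : ideal := fun p => I p /\ J p.

Definition generated_ideal (G : {mpoly k[n]} -> Prop) : ideal := fun p =>
  exists s : seq ({mpoly k[n]} * {mpoly k[n]}),
    (forall c, c \in s -> G c.2) /\ p = \sum_(c <- s) c.1 * c.2.

Definition monomial_ideal (G : {fset 'X_{1..n}}) : ideal :=
  generated_ideal (fun p => exists2 m, m \in G & p = 'X_[m]).

Definition minimal_generators (J : ideal) (G : {fset 'X_{1..n}}) : Prop :=
  same_ideal J (monomial_ideal G) /\
  forall H, (H `<=` G)%fset -> same_ideal J (monomial_ideal H) -> H = G.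

Definition minimal_generator (J : ideal) (m : 'X_{1..n}) : Prop :=
  exists2 G, minimal_generators J G & m \in G.

(* Minimal cuts form an antichain, so these generators are the minimal ones. *)
Definition network_ideal (N : network n) : ideal :=
  generated_ideal (fun p => exists2 S : {set 'I_n},
    is_minimal_cut N S & p = \prod_(s in S) 'X_s).

Inductive ideal_tree :=
| Leaf of ideal
| Node of ideal & ideal_tree & ideal_tree.

Definition root_ideal (t : ideal_tree) : ideal :=
  match t with Leaf J => J | Node J _ _ => J end.

(* G is the minimal generating set of the node J, and m is its pivot. *)
Fixpoint mv_tree (t : ideal_tree) : Prop :=
  match t with
  | Leaf J => exists m, minimal_generators J [fset m]%fset
  | Node J l r =>
      (exists (G : {fset 'X_{1..n}}) (m : 'X_{1..n}),
        [/\ minimal_generators J G, (2 <= #|` G|)%N, m \in G,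
            same_ideal (root_ideal l)
              (ideal_cap (monomial_ideal (G `\ m)%fset)
                         (monomial_ideal [fset m]%fset)) &
            same_ideal (root_ideal r) (monomial_ideal (G `\ m)%fset)])
      /\ mv_tree l /\ mv_tree r
  end.

Definition mv_tree_of (I : ideal) (t : ideal_tree) : Prop :=
  mv_tree t /\ same_ideal (root_ideal t) I.

(* [node_at t p q J]: when the root of t has position p, some node of t has
   position q and is labelled by J. *)
Fixpoint node_at (t : ideal_tree) (p q : nat) (J : ideal) : Prop :=
  match t with
  | Leaf K => q = p /\ J = K
  | Node K l r =>
      [\/ q = p /\ J = K, node_at l p.*2 q J | node_at r p.*2.+1 q J]
  end.

Definition relevant (q : nat) : bool := (q == 1%N) || ~~ odd q.

(* Distinct nodes have distinct positions, so q1 = q2 says that the two nodes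
   are the same. *)
Definition no_repeated_generator (t : ideal_tree) : Prop :=
  forall q1 q2 J1 J2 m,
    node_at t 1 q1 J1 -> node_at t 1 q2 J2 -> relevant q1 -> relevant q2 ->
    minimal_generator J1 m -> minimal_generator J2 m -> q1 = q2.

Definition mv_type_A (I : ideal) : Prop :=
  exists2 t, mv_tree_of I t & no_repeated_generator t.

End Ideals.
Arguments network_ideal k {n} N.

(* Main.v *)
Require Import Defs.
From mathcomp Require Import all_boot all_order all_algebra.
From mathcomp Require Import finmap mpoly.

(** Why the theorem holds.

    In a Mayer-Vietoris tree the right child of a node is generated by all the
    generators of the node but its pivot. So if the generators of a node are
    written as its pivot together with the generators of its right child, and
    this is repeated along the chain of right children, then the generators of
    the relevant nodes, counted with multiplicity, turn out to be exactly the
    pivots of all the nodes of the tree, the pivot of a leaf being its only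
    generator. An ideal is thus of type A when it has a tree whose pivots are
    pairwise distinct ([pivot_tree], [pivot_tree_mv_tree]).

    The ideals of networks are squarefree, and so are the least common
    multiples of their generators: a monomial is a set of edges, divisibility
    is inclusion, and an ideal is the family of its minimal generators, an
    antichain of sets. The cuts of a series union are the sets whose trace on
    one of the two networks is a cut, those of a parallel union the sets whose
    traces on both are cuts. Hence the two unions correspond to the sum and the
    product of two ideals I and J in disjoint sets of variables, and it remains
    to build trees with distinct pivots for I + J and I * J from trees of I and
    J with pivots R and S.

    - Sum ([pivot_tree_sum]). The ideals that occur have the form b I + m J,
      where all pivots of I are strict multiples of m and all those of J strict
      multiples of b. If p is the pivot of I, with children I' (right) and L
      (left), the pivot b p has the children b I' + m J and b L + p J, which
      have the same form. When I is exhausted, m times a tree of J remains. The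
      pivots are b R, m S and R S. They are distinct because of the
      strictness. For m = b = 1, strictness means that 1 is not a generator,
      and this is so because a series-parallel network is connected.

    - Product ([pivot_tree_prod]). If m is the pivot of I, with right child I',
      then I J = I' J + m J. The generators of m J are removed in the order in
      which the tree of J removes them: the right children are the ideals
      I' J + m H, for H along the chain of right children in the tree of J, and
      the left child for the pivot b of H, with left children L of I and K of
      H, is b L + m K, an ideal to which the sum construction applies. The
      pivots are R S. *)

Set Implicit Arguments.
Unset Strict Implicit.
Unset Printing Implicit Defensive.

(** * Antichains of sets and the families above them *)

Lemma disjoint_intro (T : finType) (A B : {set T}) :
  (forall x, x \in A -> x \notin B) -> [disjoint A & B].
Proof. by move=> AB; rewrite disjoint_subset; apply/subsetP=> x /AB. Qed.

Definition antichain (T : finType) (G : {set {set T}}) : Prop :=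
  {in G &, forall x y : {set T}, x \subset y -> x = y}.

(** Membership of a squarefree monomial in the ideal generated by [G]. *)
Definition above (T : finType) (G : {set {set T}}) (x : {set T}) : bool :=
  [exists g in G, g \subset x].

Lemma aboveP (T : finType) (G : {set {set T}}) (x : {set T}) :
  reflect (exists2 g, g \in G & g \subset x) (above G x).
Proof. exact: (iffP exists_inP). Qed.

Lemma mem_above (T : finType) (G : {set {set T}}) (x : {set T}) :
  x \in G -> above G x.
Proof. by move=> Gx; apply/aboveP; exists x. Qed.

Lemma above0 (T : finType) (x : {set T}) : above set0 x = false.
Proof. by apply/aboveP=> -[g]; rewrite inE. Qed.

Lemma above1 (T : finType) (m x : {set T}) : above [set m] x = (m \subset x).
Proof.
by apply/aboveP/idP => [[g /set1P->]|mx] //; exists m => //; rewrite set11.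
Qed.

Lemma aboveU (T : finType) (G H : {set {set T}}) (x : {set T}) :
  above (G :|: H) x = above G x || above H x.
Proof.
apply/aboveP/orP => [[g /setUP[] Gg gx]|[] /aboveP[g Gg gx]].
- by left; apply/aboveP; exists g.
- by right; apply/aboveP; exists g.
- by exists g => //; rewrite inE Gg.
- by exists g => //; rewrite inE Gg orbT.
Qed.

(** * Trees with distinct pivots *)

(** [pivot_tree G R]: some Mayer-Vietoris tree of the ideal generated by [G]
    has pairwise distinct pivots, forming the set [R]. In a node, [m] is the
    pivot, [G] generates the right child and [L] the left one, the intersection
    of the ideals of [G] and of [m]. The zero ideal is admitted with the empty
    tree, so that a leaf is a node with two empty children and needs no separate
    treatment. *)
Inductive pivot_tree (T : finType) :
  {set {set T}} -> {set {set T}} -> Prop :=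
| pivot_tree_nil : pivot_tree set0 set0
| pivot_tree_node (m : {set T}) (G L RG RL : {set {set T}}) :
    m \notin G -> antichain (m |: G) ->
    (forall x, above L x = (m \subset x) && above G x) ->
    pivot_tree L RL -> pivot_tree G RG ->
    m \notin RL -> m \notin RG -> [disjoint RL & RG] ->
    pivot_tree (m |: G) (m |: (RL :|: RG)).

Lemma pivot_tree_antichain (T : finType) (G R : {set {set T}}) :
  pivot_tree G R -> antichain G.
Proof. by case=> // x y; rewrite inE. Qed.

(** Every generator is the pivot of some node on the chain of right children. *)
Lemma generators_sub_pivots (T : finType) (G R : {set {set T}}) :
  pivot_tree G R -> G \subset R.
Proof.
elim=> [|m G' L RG RL _ _ _ _ _ _ sGR _ _ _]; first exact: sub0set.
by apply: setUS; apply: subset_trans sGR _; apply: subsetUr.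
Qed.

(** Both children of a node are contained in it as ideals. *)
Lemma pivots_above (T : finType) (G R : {set {set T}}) :
  pivot_tree G R -> {in R, forall r, above G r}.
Proof.
elim=> [r|m G' L RG RL _ _ eqL _ IHL _ IHG _ _ _ r]; first by rewrite inE.
rewrite !inE aboveU above1 => /or3P[/eqP->|/IHL|/IHG->].
- by rewrite subxx.
- by rewrite eqL => /andP[->].
- by rewrite orbT.
Qed.

(** * Families in disjoint sets of variables *)

Definition lpart n1 n2 (x : {set 'I_(n1 + n2)}) : {set 'I_n1} :=
  lshift n2 @^-1: x.
Definition rpart n1 n2 (x : {set 'I_(n1 + n2)}) : {set 'I_n2} :=
  @rshift n1 n2 @^-1: x.
Definition pairset n1 n2 (x : {set 'I_n1}) (y : {set 'I_n2}) :
  {set 'I_(n1 + n2)} :=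
  [set i | match split i with inl a => a \in x | inr b => b \in y end].

Lemma lpartK n1 n2 (x : {set 'I_n1}) (y : {set 'I_n2}) :
  lpart (pairset x y) = x.
Proof. by apply/setP=> i; rewrite !inE (unsplitK (inl _)). Qed.

Lemma rpartK n1 n2 (x : {set 'I_n1}) (y : {set 'I_n2}) :
  rpart (pairset x y) = y.
Proof. by apply/setP=> i; rewrite !inE (unsplitK (inr _)). Qed.

Lemma parts_subset n1 n2 (x y : {set 'I_(n1 + n2)}) :
  (x \subset y) = (lpart x \subset lpart y) && (rpart x \subset rpart y).
Proof.
apply/idP/andP => [xy|[/subsetP xyl /subsetP xyr]].
  by split; apply: preimsetS.
apply/subsetP=> i; rewrite -(splitK i); case: (split i) => a /= ax.
  by have:= xyl a; rewrite !inE; apply.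
by have:= xyr a; rewrite !inE; apply.
Qed.

Lemma parts_eq n1 n2 (x y : {set 'I_(n1 + n2)}) :
  (x == y) = (lpart x == lpart y) && (rpart x == rpart y).
Proof. by rewrite !eqEsubset (parts_subset x) (parts_subset y) andbACA. Qed.

(** The generators of a product of ideals in disjoint variables. Since a set is
    determined by its two parts, membership in all the families below reduces to
    propositional logic on the parts. *)
Definition prodfam n1 n2 (G : {set {set 'I_n1}}) (H : {set {set 'I_n2}}) :
  {set {set 'I_(n1 + n2)}} :=
  [set x | (lpart x \in G) && (rpart x \in H)].

Lemma above_prodfam n1 n2 (G : {set {set 'I_n1}}) (H : {set {set 'I_n2}}) x :
  above (prodfam G H) x = above G (lpart x) && above H (rpart x).
Proof.
apply/aboveP/andP => [[g]|[/aboveP[g Gg gx] /aboveP[h Hh hx]]].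
  rewrite inE parts_subset => /andP[Gg Hg] /andP[gx hx].
  by split; apply/aboveP; [exists (lpart g) | exists (rpart g)].
exists (pairset g h); first by rewrite inE lpartK rpartK Gg.
by rewrite parts_subset lpartK rpartK gx.
Qed.

Lemma antichain_prodfam n1 n2 (G : {set {set 'I_n1}}) (H : {set {set 'I_n2}}) :
  antichain G -> antichain H -> antichain (prodfam G H).
Proof.
move=> aG aH x y; rewrite !inE parts_subset => /andP[Gx Hx] /andP[Gy Hy].
case/andP=> xyl xyr; apply/eqP; rewrite parts_eq.
by rewrite (aG _ _ Gx Gy xyl) (aH _ _ Hx Hy xyr) !eqxx.
Qed.

(** Multiplying all the nodes of a tree by a monomial in new variables keeps it
    a tree. *)
Lemma pivot_tree_prodfam1 n1 n2 (m : {set 'I_n1}) (G R : {set {set 'I_n2}}) :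
  pivot_tree G R -> pivot_tree (prodfam [set m] G) (prodfam [set m] R).
Proof.
have aM : antichain [set m] by move=> x y /set1P-> /set1P->.
elim=> [|p G' L RG RL pG aG eqL _ IHL _ IHG pRL pRG dis].
  rewrite (_ : prodfam _ _ = set0); first exact: pivot_tree_nil.
  by apply/setP=> x; rewrite !inE andbF.
have eqU A : prodfam [set m] (p |: A) = pairset m p |: prodfam [set m] A.
  by apply/setP=> x; rewrite !inE parts_eq lpartK rpartK andb_orr.
have eqR : prodfam [set m] (RL :|: RG) =
    prodfam [set m] RL :|: prodfam [set m] RG.
  by apply/setP=> x; rewrite !inE andb_orr.
rewrite !eqU eqR; apply: (@pivot_tree_node _ _ _ (prodfam [set m] L)) => //.
- by rewrite inE lpartK rpartK negb_and pG orbT.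
- by rewrite -eqU; apply: antichain_prodfam.
- move=> x; rewrite !above_prodfam eqL above1 parts_subset lpartK rpartK.
  by case: (m \subset _); rewrite ?andbF.
- by rewrite inE lpartK rpartK negb_and pRL orbT.
- by rewrite inE lpartK rpartK negb_and pRG orbT.
- rewrite disjoint_subset; apply/subsetP=> x; rewrite !inE => /andP[_ RLx].
  by rewrite negb_and (disjointFr dis RLx) orbT.
Qed.

Definition above_strictly (T : finType) (m : {set T}) (R : {set {set T}}) :=
  {in R, forall r : {set T}, (m \subset r) && (m != r)}.

(** In a node the left pivots are multiples of the pivot [m], and distinct from
    it; this is what makes the strictness hypotheses of [pivot_tree_sum]
    available below a node. *)
Lemma left_pivots_above (T : finType) (m : {set T})
    (G L RL : {set {set T}}) :
  (forall x : {set T}, above L x = (m \subset x) && above G x) ->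
  pivot_tree L RL -> m \notin RL -> above_strictly m RL.
Proof.
move=> eqL treeL mRL r RLr; have := pivots_above treeL RLr.
by rewrite eqL => /andP[-> _] /=; apply: contraNneq mRL => ->.
Qed.

(** The case [m = b = set0] is the sum of two ideals in disjoint variables. The
    statement is shaped for the induction: at the left child of the pivot [p] of
    [G1] the monomial [p] takes the place of [m], which is why [m] is
    universally quantified in the induction hypothesis while [b] is fixed. *)
Lemma pivot_tree_sum n1 n2 (m : {set 'I_n1}) (b : {set 'I_n2}) G1 R1 G2 R2 :
  pivot_tree G1 R1 -> pivot_tree G2 R2 ->
  above_strictly m R1 -> above_strictly b R2 ->
  pivot_tree (prodfam G1 [set b] :|: prodfam [set m] G2)
             (prodfam R1 [set b] :|: prodfam [set m] R2 :|: prodfam R1 R2).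
Proof.
move=> tree1 tree2 + bR2; elim: tree1 m => {G1 R1}.
  move=> m _; rewrite (_ : _ :|: _ = prodfam [set m] G2); last first.
    by apply/setP=> x; rewrite !inE.
  rewrite (_ : _ :|: _ = prodfam [set m] R2); last first.
    by apply/setP=> x; rewrite !inE /= orbF.
  exact: pivot_tree_prodfam1.
move=> p G L RG RL pG aG eqL treeL IHL treeG IHG pRL pRG dis m mR.
have mp : (m \subset p) && (m != p) by apply: mR; rewrite !inE eqxx.
have {mp} [mp m_neq_p] := andP mp.
have mRL r : r \in RL -> (r == m) = false.
  move=> RLr; apply/eqP=> rm; have := mR r; rewrite !inE RLr orbT rm eqxx andbF.
  by move/(_ isT).
have bR r : r \in R2 -> (r == b) = false.
  by move/bR2=> /andP[_ /negbTE]; rewrite eq_sym.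
have bG g : g \in G2 -> (b \subset g) && (g != b).
  move=> G2g; have R2g := subsetP (generators_sub_pivots tree2) _ G2g.
  by have /andP[-> _] := bR2 _ R2g; rewrite bR.
have pL := left_pivots_above eqL treeL pRL.
have mRGs : above_strictly m RG.
  by move=> r RGr; apply: mR; rewrite !inE RGr !orbT.
have eqG : prodfam (p |: G) [set b] :|: prodfam [set m] G2 =
    pairset p b |: (prodfam G [set b] :|: prodfam [set m] G2).
  by apply/setP=> x; rewrite !inE parts_eq lpartK rpartK andb_orl orbA.
rewrite eqG.
rewrite (_ : _ :|: _ :|: _ = pairset p b |:
   ((prodfam RL [set b] :|: prodfam [set p] R2 :|: prodfam RL R2) :|:
    (prodfam RG [set b] :|: prodfam [set m] R2 :|: prodfam RG R2))); last first.
  apply/setP=> x; rewrite !inE parts_eq lpartK rpartK.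
  move: (lpart x == p) (lpart x == m) (rpart x == b) => lp lm rb.
  move: (_ \in RL) (_ \in RG) (_ \in R2) => lL lG r2.
  by case: lp; case: lL; case: lG; case: lm; case: rb; case: r2.
apply: (@pivot_tree_node _ _ _ (prodfam L [set b] :|: prodfam [set p] G2)).
- by rewrite !inE lpartK rpartK (negbTE pG) [p == m]eq_sym (negbTE m_neq_p).
- rewrite -eqG => x y; rewrite !inE parts_subset => Gx Gy /andP[xyl xyr].
  apply/eqP; rewrite parts_eq; move: Gx Gy.
  have aG2 := pivot_tree_antichain tree2.
  have mpG g : (g == p) || (g \in G) -> (m \subset g) && (m != g).
    move=> Gg; apply: mR; move: Gg; rewrite !inE => /orP[->//|].
    by move/(subsetP (generators_sub_pivots treeG))=> ->; rewrite !orbT.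
  case/orP=> /andP[Gx Hx]; case/orP=> /andP[Gy Hy].
  - have -> : lpart x = lpart y by apply: aG => //; rewrite !inE.
    by rewrite (eqP Hx) (eqP Hy) !eqxx.
  - have /andP[mx /eqP[]] := mpG _ Gx; apply/eqP.
    by rewrite eqEsubset mx -(eqP Gy).
  - have /andP[bx /eqP[]] := bG _ Hx; apply/eqP.
    by rewrite eqEsubset bx -(eqP Hy) xyr.
  - by rewrite (aG2 _ _ Hx Hy xyr) (eqP Gx) (eqP Gy) !eqxx.
- move=> x; rewrite !aboveU !above_prodfam !above1 eqL.
  rewrite parts_subset lpartK rpartK.
  have p_le: p \subset lpart x -> m \subset lpart x by apply: subset_trans.
  have b_le: above G2 (rpart x) -> b \subset rpart x.
    by case/aboveP=> g /bG /andP[bg _]; apply: subset_trans.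
  have [bx|nb] := boolP (b \subset _).
    by case: (p \subset _) p_le => //= ->//; rewrite andbT.
  by rewrite (contraNF b_le nb) !andbF.
- exact: IHL.
- exact: IHG.
- have bNR : b \notin R2 by apply/negP=> bR2b; have := bR _ bR2b; rewrite eqxx.
  by rewrite !inE lpartK rpartK (negbTE pRL) (negbTE bNR) andbF.
- by rewrite !inE lpartK rpartK (negbTE pRG) [p == m]eq_sym (negbTE m_neq_p).
- (* The parts in the first set of variables already separate the two sides. *)
  apply: disjoint_intro => x Lx; apply/negP=> Rx.
  have {Lx}: (lpart x == p) || (lpart x \in RL).
    by move: Lx; rewrite !inE -!orbA => /or3P[]/andP[-> _]; rewrite ?orbT.
  have {Rx}: (lpart x == m) || (lpart x \in RG).
    by move: Rx; rewrite !inE -!orbA => /or3P[]/andP[-> _]; rewrite ?orbT.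
  case/orP=> [/eqP->|RGx] /orP[/eqP xp|RLx].
  - by rewrite xp eqxx in m_neq_p.
  - by have := mRL _ RLx; rewrite eqxx.
  - by rewrite xp (negbTE pRG) in RGx.
  - by rewrite (disjointFr dis RLx) in RGx.
Qed.

(** The pivots are those of the tensor product of the two resolutions. *)
Lemma pivot_tree_prod n1 n2 (G1 R1 : {set {set 'I_n1}})
    (G2 R2 : {set {set 'I_n2}}) :
  pivot_tree G1 R1 -> pivot_tree G2 R2 ->
  pivot_tree (prodfam G1 G2) (prodfam R1 R2).
Proof.
move=> tree1 tree2; have aG2 := pivot_tree_antichain tree2.
elim: tree1 => {G1 R1}.
  have prodfam0 H :
      prodfam (set0 : {set {set 'I_n1}}) H = set0 :> {set {set 'I_(n1 + n2)}}.
    by apply/setP=> x; rewrite !inE.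
  by rewrite !prodfam0; apply: pivot_tree_nil.
move=> m G L RG RL mG aG eqL treeL _ treeG IHG mRL mRG disLG.
have mL := left_pivots_above eqL treeL mRL.
(* [H] runs along the chain of right children in the tree of [G2]; the monomials
   [m * h] with [h] in [H] are those that are still to be removed. *)
suff row H RH : pivot_tree H RH -> H \subset G2 ->
    pivot_tree (prodfam [set m] H :|: prodfam G G2)
      (prodfam (m |: RL) RH :|: prodfam RG R2).
  have {row} := row _ _ tree2 (subxx _).
  congr pivot_tree; apply/setP=> x; rewrite !inE.
    by rewrite andb_orl.
  by rewrite -andb_orl orbA.
elim=> {H RH} [_|b H K RH RK bH aH eqK treeK _ treeH IHH bRK bRH disKH].
  rewrite (_ : _ :|: _ = prodfam G G2); last first.
    by apply/setP=> x; rewrite !inE andbF.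
  rewrite (_ : prodfam (m |: RL) _ :|: _ = prodfam RG R2) //.
  by apply/setP=> x; rewrite !inE andbF.
rewrite subUset sub1set => /andP[G2b sHG].
have bK := left_pivots_above eqK treeK bRK.
have eqG : prodfam [set m] (b |: H) :|: prodfam G G2 =
    pairset m b |: (prodfam [set m] H :|: prodfam G G2).
  by apply/setP=> x; rewrite !inE parts_eq lpartK rpartK andb_orr orbA.
rewrite eqG.
rewrite (_ : prodfam (m |: RL) _ :|: _ = pairset m b |:
   ((prodfam RL [set b] :|: prodfam [set m] RK :|: prodfam RL RK) :|:
    (prodfam (m |: RL) RH :|: prodfam RG R2))); last first.
  apply/setP=> x; rewrite !inE parts_eq lpartK rpartK.
  move: (lpart x == m) (rpart x == b) (_ && (_ \in R2)) => lm rb xGR.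
  move: (_ \in RL) (_ \in RK) (_ \in RH) => lL rK rH.
  by case: lm; case: lL; case: rb; case: rK; case: rH.
apply: (@pivot_tree_node _ _ _ (prodfam L [set b] :|: prodfam [set m] K)).
- by rewrite !inE lpartK rpartK (negbTE bH) (negbTE mG) andbF.
- rewrite -eqG => x y xG yG xy; move: (xG) (yG).
  have sub z : z \in prodfam [set m] (b |: H) :|: prodfam G G2 ->
      z \in prodfam (m |: G) G2.
    rewrite !inE => /orP[/andP[-> Hz]|/andP[-> ->]]; last by rewrite orbT.
    by case/orP: Hz => [/eqP->|/(subsetP sHG)->].
  by move=> /sub xP /sub yP; apply: (antichain_prodfam aG aG2 xP yP).
- move=> x; rewrite !aboveU !above_prodfam !above1 eqL eqK.
  rewrite parts_subset lpartK rpartK.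
  have [bx|_] := boolP (b \subset _); last by rewrite !andbF.
  (* The ideal of [G] times that of [G2] meets the multiples of [b] in all the
     multiples of [b] that lie in the ideal of [G], as [b] is in [G2]. *)
  have -> : above G2 (rpart x) by apply/aboveP; exists b.
  by rewrite !andbT; case: (m \subset _); rewrite //= orbC.
- exact: pivot_tree_sum.
- exact: IHH.
- by rewrite !inE lpartK rpartK (negbTE mRL) (negbTE bRK) !andbF.
- by rewrite !inE lpartK rpartK (negbTE mRG) (negbTE bRH) !andbF.
- apply: disjoint_intro => x; rewrite !inE -!orbA => Lx; apply/negP.
  have Lx1 : (lpart x == m) || (lpart x \in RL).
    by case/or3P: Lx => /andP[-> _]; rewrite ?orbT.
  have Lx2 : (rpart x == b) || (rpart x \in RK).
    by case/or3P: Lx => /andP[_ ->]; rewrite ?orbT.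
  case/orP=> /andP[].
    move=> _; case/orP: Lx2 => [/eqP->|Rx]; first by rewrite (negbTE bRH).
    by rewrite (disjointFr disKH Rx).
  case/orP: Lx1 => [/eqP->|Rx]; first by rewrite (negbTE mRG).
  by rewrite (disjointFr disLG Rx).
Qed.

(** * Renaming the variables *)

Lemma subset_preimset (T T' : finType) (f : T -> T') (x y : {set T'}) :
  bijective f -> (f @^-1: x \subset f @^-1: y) = (x \subset y).
Proof.
case=> g _ gK; apply/subsetP/subsetP=> [xy a|xy a]; last by rewrite !inE => /xy.
by rewrite -(gK a) => ax; have := xy (g a); rewrite !inE; apply.
Qed.

Definition relabelled (T T' : finType) (f : T -> T') (G : {set {set T}}) :
  {set {set T'}} := [set x : {set T'} | f @^-1: x \in G].

Lemma preimset_onto (T T' : finType) (f : T -> T') (x : {set T}) :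
  bijective f -> f @^-1: (f @: x) = x.
Proof.
by move=> /bij_inj inj_f; apply/setP=> a; rewrite inE mem_imset.
Qed.

Lemma above_relabelled (T T' : finType) (f : T -> T') (G : {set {set T}})
    (x : {set T'}) :
  bijective f -> above (relabelled f G) x = above G (f @^-1: x).
Proof.
move=> bij_f; apply/aboveP/aboveP => [[g]|[g Gg gx]].
  by rewrite inE => Gg gx; exists (f @^-1: g); rewrite ?subset_preimset.
exists (f @: g); first by rewrite inE preimset_onto.
by rewrite sub_imset_pre.
Qed.

Lemma antichain_relabelled (T T' : finType) (f : T -> T') (G : {set {set T}}) :
  bijective f -> antichain G -> antichain (relabelled f G).
Proof.
move=> bij_f aG x y; rewrite !inE => Gx Gy xy.
have fxy : f @^-1: x = f @^-1: y by apply: aG => //; rewrite subset_preimset.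
by apply/eqP; rewrite eqEsubset xy -(subset_preimset y x bij_f) fxy subxx.
Qed.

Lemma pivot_tree_relabelled (T T' : finType) (f : T -> T')
    (G R : {set {set T}}) :
  bijective f -> pivot_tree G R -> pivot_tree (relabelled f G) (relabelled f R).
Proof.
move=> bij_f; elim=> [|m {}G L RG RL mG aG eqL _ IHL _ IHG mRL mRG dis].
  by rewrite (_ : relabelled f _ = set0); [left | apply/setP=> x; rewrite !inE].
have relU1 A : relabelled f (m |: A) = f @: m |: relabelled f A.
  apply/setP=> x; rewrite !inE; congr (_ || _); rewrite !eqEsubset.
  by rewrite -{1 2}(preimset_onto m bij_f) !subset_preimset.
have relU A B : relabelled f (A :|: B) = relabelled f A :|: relabelled f B.
  by apply/setP=> x; rewrite !inE.
rewrite !relU1 relU; apply: (@pivot_tree_node _ _ _ (relabelled f L)) => //.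
- by rewrite inE preimset_onto.
- by rewrite -relU1; apply: antichain_relabelled.
- by move=> x; rewrite !above_relabelled // eqL sub_imset_pre.
- by rewrite inE preimset_onto.
- by rewrite inE preimset_onto.
- by apply: disjoint_intro => x; rewrite !inE => /(disjointFr dis)->.
Qed.

(** * Cuts of series-parallel networks *)

(** A cut amounts to a two-colouring of the nodes that separates the input from
    the output and is constant along the surviving edges. Unlike paths, such
    colourings restrict to the parts of a union and glue back directly. *)
Lemma is_cutP n (N : network n) (S : {set 'I_n}) :
  reflect (exists c : pred (node N),
             [/\ c (input N), ~~ c (output N) &
                 forall e, e \notin S -> c (ends N e).1 = c (ends N e).2])
          (is_cut N S).
Proof.
pose r := [rel u v : node N | [exists e, (e \notin S) && joins N e u v]].
apply: (iffP idP) => [cutS|[c [c_in c_out c_ends]]].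
  exists (connect r (input N)); split=> [|//|e eS]; first exact: connect0.
  have rsym : ssrbool.symmetric r.
    by move=> u v; apply: eq_existsb => i; rewrite /joins orbC.
  apply: (same_connect_r (sym_connect_sym rsym)) .
  apply: connect1; apply/existsP; exists e.
  by rewrite eS /joins -surjective_pairing eqxx.
have cl : closed r c.
  move=> u v /existsP[e /andP[eS /orP[]/eqP euv]]; have := c_ends e eS;
  by rewrite euv.
apply/negP=> /(closed_connect cl).
by rewrite !unfold_in c_in (negbTE c_out).
Qed.

Lemma is_cut_mono n (N : network n) (S S' : {set 'I_n}) :
  S \subset S' -> is_cut N S -> is_cut N S'.
Proof.
move=> SS' /is_cutP[c [ci co ce]]; apply/is_cutP; exists c; split=> // e eS'.
by apply: ce; apply: contra eS'; apply: subsetP.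
Qed.

Definition minimal_cuts n (N : network n) : {set {set 'I_n}} :=
  [set S | is_minimal_cut N S].

Lemma above_minimal_cuts n (N : network n) (S : {set 'I_n}) :
  above (minimal_cuts N) S = is_cut N S.
Proof.
apply/aboveP/idP => [[C]|/minset_exists[C minC CS]].
  by rewrite inE => /minsetp cutC /is_cut_mono; apply.
by exists C; rewrite ?inE.
Qed.

(** An ideal has only one minimal generating set; thanks to this the minimal
    cuts of a union are found from its cuts alone. *)
Lemma minimal_cuts_unique n (N : network n) (M : {set {set 'I_n}}) :
  antichain M -> (forall S, above M S = is_cut N S) -> minimal_cuts N = M.
Proof.
move=> aM eqM; apply/setP=> S; rewrite inE; apply/idP/idP => [minS|MS].
  have /aboveP[C MC CS] : above M S by rewrite eqM (minsetp minS).
  have cutC : is_cut N C by rewrite -eqM mem_above.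
  by rewrite -(minsetinf minS cutC CS).
apply/minsetP; split=> [|C]; first by rewrite -eqM mem_above.
rewrite -eqM => /aboveP[D MD DC] CS; apply/eqP; rewrite eqEsubset CS.
by rewrite -{1}(aM _ _ MD MS (subset_trans DC CS)).
Qed.

Lemma is_cut_one_edge (S : {set 'I_1}) : is_cut one_edge S = (ord0 \in S).
Proof.
apply/is_cutP/idP => [[c [ci co ce]]|S0].
  by apply: contraLR ci => /ce /= ->.
by exists (pred1 false); split=> // e; rewrite (ord1 e) S0.
Qed.

Lemma is_cut_series n1 n2 (N1 : network n1) (N2 : network n2) S :
  is_cut (series_union N1 N2) S = is_cut N1 (lpart S) || is_cut N2 (rpart S).
Proof.
apply/is_cutP/orP => [[c [ci co ce]]|[] /is_cutP[c [ci co ce]]].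
- (* The colour of the shared node tells which network is cut. *)
  have [cm|cm] := boolP (c (series_inr N1 (input N2)));
    [right|left]; apply/is_cutP.
    exists (fun v => c (series_inr N1 v)); split=> // e; rewrite inE => /ce.
    by rewrite /= /glue_ends (unsplitK (inr e)).
  exists (fun v => c (series_inl N2 v)); split=> //.
    by move: cm; rewrite /series_inr insubF ?eqxx.
  move=> e; rewrite inE => /ce.
  by rewrite /= /glue_ends (unsplitK (inl e)).
- exists (fun v => if v is inl u then c u else false).
  have inrF v : (if series_inr N1 v is inl u then c u else false) = false.
    by rewrite /series_inr; case: insubP => //= _; apply: negbTE.
  split=> //; first by rewrite inrF.
  move=> e; rewrite /= /glue_ends -(splitK e) unsplitK.
  case: (split e) => a /= aS; last by rewrite !inrF.
  by apply: ce; rewrite inE.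
exists (fun v => if v is inr u then c (val u) else true).
have inrE v : (if series_inr N1 v is inr u then c (val u) else true) = c v.
  rewrite /series_inr; case: insubP => [u _ -> //|].
  by rewrite negbK => /eqP->; rewrite ci.
split=> //; first by rewrite inrE.
move=> e; rewrite /= /glue_ends -(splitK e) unsplitK.
case: (split e) => a //= aS; rewrite !inrE.
by apply: ce; rewrite inE.
Qed.

Lemma is_cut_parallel n1 n2 (N1 : network n1) (N2 : network n2) S :
  is_cut (parallel_union N1 N2) S = is_cut N1 (lpart S) && is_cut N2 (rpart S).
Proof.
apply/is_cutP/andP => [[c [ci co ce]]|].
  have inr_in : parallel_inr N1 (input N2) = inl (input N1).
    by rewrite /parallel_inr insubF eqxx.
  have inr_out : parallel_inr N1 (output N2) = inl (output N1).
    rewrite /parallel_inr insubF ?eqxx ?andbF //.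
    by rewrite eq_sym (negbTE (input_neq_output N2)).
  split; apply/is_cutP.
    exists (fun v => c (parallel_inl N2 v)); split=> // e; rewrite inE => /ce.
    by rewrite /= /glue_ends (unsplitK (inl e)).
  exists (fun v => c (parallel_inr N1 v)); rewrite inr_in inr_out.
  split=> // e; rewrite inE => /ce.
  by rewrite /= /glue_ends (unsplitK (inr e)).
case=> /is_cutP[c [ci co ce]] /is_cutP[d [di do_ de]].
exists (fun v => match v with inl u => c u | inr u => d (val u) end).
have inrE v :
    match parallel_inr N1 v with inl u => c u | inr u => d (val u) end = d v.
  rewrite /parallel_inr; case: insubP => [u _ -> //|].
  rewrite negb_and !negbK; case: eqP => [-> _|_ /= /eqP->]; first by rewrite ci.
  by rewrite (negbTE co) (negbTE do_).
split=> // e; rewrite /= /glue_ends -(splitK e) unsplitK.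
case: (split e) => a /= aS; rewrite ?inrE.
  by apply: ce; rewrite inE.
by apply: de; rewrite inE.
Qed.

Lemma joins_ends n (N : network n) e (c : pred (node N)) :
  c (ends N e).1 = c (ends N e).2 <-> (forall u v, joins N e u v -> c u = c v).
Proof.
split=> [ce u v /orP[] /eqP euv|].
- by rewrite euv in ce.
- by rewrite euv in ce.
by apply; rewrite /joins -surjective_pairing eqxx.
Qed.

Lemma is_cut_iso n (N N' : network n) (f : node N -> node N') g
    (S : {set 'I_n}) :
  bijective f -> bijective g ->
  f (input N) = input N' -> f (output N) = output N' ->
  (forall e u v, joins N' (g e) (f u) (f v) = joins N e u v) ->
  is_cut N' S = is_cut N (g @^-1: S).
Proof.
move=> [f' fK f'K] [g' gK g'K] fi fo fj.
apply/is_cutP/is_cutP => -[c [ci co ce]].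
  exists (c \o f); rewrite /= fi fo; split=> // e; rewrite inE => /ce ge.
  apply/(joins_ends e (c \o f)) => u v; rewrite -fj.
  exact: (iffLR (joins_ends _ c) ge).
exists (c \o f'); rewrite /= -fi -fo !fK; split=> // e eS.
apply/(joins_ends e (c \o f')) => u v.
rewrite -(f'K u) -(f'K v) -(g'K e) fj /= !fK.
by apply: (iffLR (joins_ends _ c)); apply: ce; rewrite inE g'K.
Qed.

Lemma series_parallel_connected n (N : network n) :
  series_parallel N -> ~~ is_cut N set0.
Proof.
have lpart0 n1 n2 : lpart (set0 : {set 'I_(n1 + n2)}) = set0.
  by rewrite /lpart preimset0.
have rpart0 n1 n2 : rpart (set0 : {set 'I_(n1 + n2)}) = set0.
  by rewrite /rpart preimset0.
elim=> [|n1 n2 N1 N2 _ c1 _ c2|n1 n2 N1 N2 _ c1 _ _|{}n {}N N'].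
- by rewrite is_cut_one_edge inE.
- by rewrite is_cut_series lpart0 rpart0 negb_or c1.
- by rewrite is_cut_parallel lpart0 negb_and c1.
case=> f [g [bf bg fi fo fj]] _.
by rewrite (is_cut_iso _ bf bg fi fo fj) preimset0.
Qed.

Lemma minimal_cuts_neq0 n (N : network n) : minimal_cuts N != set0.
Proof.
have: above (minimal_cuts N) setT.
  rewrite above_minimal_cuts; apply/is_cutP; exists (pred1 (input N)).
  split=> /=; first exact: eqxx.
    by rewrite eq_sym input_neq_output.
  by move=> e; rewrite inE.
by apply: contraTneq => ->; rewrite above0.
Qed.

Lemma minimal_cuts_pivot_tree n (N : network n) :
  series_parallel N -> exists R, pivot_tree (minimal_cuts N) R.
Proof.
elim=> [|n1 n2 N1 N2 sp1 [R1 t1] sp2 [R2 t2]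
        |n1 n2 N1 N2 _ [R1 t1] _ [R2 t2]
        |{}n {}N N' [f [g [bf bg fi fo fj]]] _ [R t]].
- exists ([set ord0] |: (set0 :|: set0)).
  rewrite (@minimal_cuts_unique _ _ ([set ord0] |: set0)).
  + apply: (@pivot_tree_node _ _ _ set0); rewrite ?inE //;
      try exact: pivot_tree_nil.
    * by move=> x y; rewrite !inE !orbF => /eqP-> /eqP->.
    * by move=> x; rewrite above0 andbF.
    * by rewrite -setI_eq0 setI0.
  + by move=> x y; rewrite !inE !orbF => /eqP-> /eqP->.
  + by move=> S; rewrite setU0 above1 is_cut_one_edge sub1set.
- have strict n' (N' : network n') R : series_parallel N' ->
      pivot_tree (minimal_cuts N') R -> above_strictly set0 R.
    move=> spN' tN' r Rr; rewrite sub0set /= eq_sym.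
    apply: contraNneq (series_parallel_connected spN') => <-.
    by rewrite -above_minimal_cuts (pivots_above tN').
  have tree := pivot_tree_sum t1 t2 (strict _ _ _ sp1 t1) (strict _ _ _ sp2 t2).
  eexists; rewrite (minimal_cuts_unique (pivot_tree_antichain tree)).
    exact: tree.
  move=> S; rewrite aboveU !above_prodfam !above1 !sub0set andbT /=.
  by rewrite !above_minimal_cuts is_cut_series.
- have tree := pivot_tree_prod t1 t2; exists (prodfam R1 R2).
  rewrite (minimal_cuts_unique (pivot_tree_antichain tree)) // => S.
  by rewrite above_prodfam !above_minimal_cuts is_cut_parallel.
have tree := pivot_tree_relabelled bg t; exists (relabelled g R).
rewrite (minimal_cuts_unique (pivot_tree_antichain tree)) // => S.
by rewrite above_relabelled // above_minimal_cuts (is_cut_iso _ bf bg fi fo fj).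
Qed.

(** * Squarefree monomial ideals *)

Lemma mem_monomial_ideal (k : fieldType) n (G : {fset 'X_{1..n}}) p :
  monomial_ideal (k := k) G p <->
  {in msupp p, forall m, exists2 g, g \in G & (g <= m)%MM}.
Proof.
split=> [[s [sG ->]] m|suppG].
  move/msupp_sum_le; rewrite filter_predT => /flattenP[ms /mapP[c cs ->]].
  have [g Gg ->] := sG c cs.
  rewrite (perm_mem (msuppMX _ _)) => /mapP[m' _ ->].
  by exists g => //; apply: lem_addr.
rewrite [p]mpolyE big_seq; elim/big_ind: _ => [|q r|m /suppG[g Gg gm]].
- by exists [::]; rewrite big_nil.
- move=> [s [sG ->]] [t [tG ->]]; exists (s ++ t).
  rewrite big_cat; split=> // c.
  by rewrite mem_cat => /orP[/sG|/tG].
exists [:: (p@_m *: 'X_[m - g], 'X_[g])%R]; split.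
  by move=> c; rewrite inE => /eqP-> /=; exists g.
by rewrite big_seq1 /= -GRing.scalerAl -mpolyXD submK.
Qed.

Definition monomials n (G : {set {set 'I_n}}) : {fset 'X_{1..n}} :=
  [fset mesym1 S | S in G]%fset.

Definition family_ideal (k : fieldType) n (G : {set {set 'I_n}}) : ideal k n :=
  monomial_ideal (monomials G).
Arguments family_ideal k {n} G.

Definition mnm_support n (m : 'X_{1..n}) : {set 'I_n} := [set i | m i != 0].

Lemma mem_monomials n (G : {set {set 'I_n}}) S :
  (mesym1 S \in monomials G) = (S \in G).
Proof.
apply/imfsetP/idP => [[T /= GT /inj_mesym1->] //|GS].
by exists S.
Qed.

Lemma monomialsP n (G : {set {set 'I_n}}) m :
  reflect (exists2 S, S \in G & m = mesym1 S) (m \in monomials G).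
Proof.
by apply: (iffP (imfsetP _ _ _ _)) => -[S GS ->]; exists S.
Qed.

Lemma mesym1_le n (S : {set 'I_n}) m :
  (mesym1 S <= m)%MM = (S \subset mnm_support m).
Proof.
apply/mnm_lepP/subsetP => [le i iS|sub i].
  by have := le i; rewrite mnmE iS inE lt0n.
by rewrite mnmE; case: (boolP (i \in S)) => // /sub; rewrite inE lt0n.
Qed.

Lemma mnm_support_mesym1 n (S : {set 'I_n}) : mnm_support (mesym1 S) = S.
Proof. by apply/setP=> i; rewrite inE mnmE; case: (i \in S). Qed.

(** A squarefree monomial divides [m] exactly when it divides the radical of
    [m], so comparing such ideals reduces to comparing families of sets. *)
Lemma mem_family_ideal (k : fieldType) n (G : {set {set 'I_n}}) p :
  family_ideal k G p <-> {in msupp p, forall m, above G (mnm_support m)}.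
Proof.
split=> [/mem_monomial_ideal gen m /gen[g /monomialsP[S GS ->]]|gen].
  by rewrite mesym1_le => Sm; apply/aboveP; exists S.
apply/mem_monomial_ideal => m /gen/aboveP[S GS Sm].
by exists (mesym1 S); rewrite ?mem_monomials ?mesym1_le.
Qed.

Lemma mem_family_idealX (k : fieldType) n (G : {set {set 'I_n}})
    (S : {set 'I_n}) :
  family_ideal k G 'X_[mesym1 S] <-> above G S.
Proof.
split=> [/mem_family_ideal gen|GS].
  have := gen (mesym1 S); rewrite msuppX mem_seq1 eqxx mnm_support_mesym1.
  exact.
apply/mem_family_ideal=> m; rewrite msuppX mem_seq1 => /eqP->.
by rewrite mnm_support_mesym1.
Qed.

Lemma antichain_minimal_generators (k : fieldType) n (G : {set {set 'I_n}}) :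
  antichain G -> minimal_generators (family_ideal k G) (monomials G).
Proof.
move=> aG; split=> [//|H sHG eqH].
apply/eqP; rewrite eqEfsubset sHG /=; apply/fsubsetP=> _ /monomialsP[S GS ->].
have /eqH/mem_monomial_ideal gen : family_ideal k G 'X_[mesym1 S].
  by apply/mem_family_idealX/mem_above.
have [|h Hh hS] := gen (mesym1 S); first by rewrite msuppX mem_seq1.
have /monomialsP[T GT eqh] := fsubsetP sHG _ Hh.
move: hS; rewrite eqh mesym1_le mnm_support_mesym1 => /(aG _ _ GT GS) <-.
by rewrite -eqh.
Qed.

(** A minimal generating set contains the antichain: a generator of the
    antichain is a multiple of an element of the set, itself a multiple of an
    element of the antichain. As the antichain generates the ideal, minimality
    leaves room for nothing else. *)
Lemma minimal_generators_unique (k : fieldType) n (G : {set {set 'I_n}}) H :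
  antichain G -> minimal_generators (family_ideal k G) H -> H = monomials G.
Proof.
move=> aG [eqH minH]; symmetry; apply: minH => //.
apply/fsubsetP=> _ /monomialsP[S GS ->].
have /eqH/mem_monomial_ideal gen : family_ideal k G 'X_[mesym1 S].
  by apply/mem_family_idealX/mem_above.
have [|h Hh hS] := gen (mesym1 S); first by rewrite msuppX mem_seq1.
have /eqH/mem_monomial_ideal genh : monomial_ideal (k := k) H 'X_[h].
  apply/mem_monomial_ideal => m; rewrite msuppX mem_seq1 => /eqP->.
  by exists h => //; apply/mnm_lepP.
have [|_ /monomialsP[T GT ->] Th] := genh h; first by rewrite msuppX mem_seq1.
have eqTS : T = S.
  apply: aG => //; rewrite -(mnm_support_mesym1 S) -mesym1_le.
  by apply/mnm_lepP=> i; apply: leq_trans (mnm_lepP hS i); apply: (mnm_lepP Th).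
suff -> : mesym1 S = h by [].
by apply/mnmP=> i; apply/eqP; rewrite eqn_leq (mnm_lepP hS) -eqTS (mnm_lepP Th).
Qed.

Lemma minimal_generatorE (k : fieldType) n (G : {set {set 'I_n}}) m :
  antichain G -> minimal_generator (family_ideal k G) m <-> m \in monomials G.
Proof.
move=> aG; split=> [[H /(minimal_generators_unique aG)->]|Gm] //.
by exists (monomials G) => //; apply: antichain_minimal_generators.
Qed.

(** * From pivots to Mayer-Vietoris trees *)

Lemma node_at_ge (k : fieldType) n (t : ideal_tree k n) p q J :
  node_at t p q J -> p <= q.
Proof.
elim: t p => [K|K l IHl r IHr] p /= => [[->] //|].
case=> [[->] //|/IHl le|/IHr le]; apply: leq_trans le; rewrite -addnn.
  exact: leq_addr.
by rewrite -addnS leq_addr.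
Qed.

(** [relevant] for a subtree whose root has position [p]: that root counts even
    when [p] is odd. The induction over subtrees needs this, because at a right
    child the generators other than the pivot of the parent sit at the root. *)
Definition relevant_from (p q : nat) := (q == p) || ~~ odd q.

Lemma node_at_root (k : fieldType) n (t : ideal_tree k n) p :
  node_at t p p (root_ideal t).
Proof. by case: t => [J|J l r] //=; constructor. Qed.

(** The generators of the relevant nodes are pivots, and distinct pivots force
    distinct generators. A generator of the root that reappears at an even
    position cannot be the pivot, which is not a pivot further down; so it is a
    generator of the right child, it is not a left pivot, and inside the right
    subtree the induction hypothesis puts it at the odd position of the root of
    that subtree only. *)
Lemma pivot_tree_mv_tree (k : fieldType) n (G R : {set {set 'I_n}}) :
  pivot_tree G R -> G != set0 ->
  exists t : ideal_tree k n, [/\ mv_tree t, root_ideal t = family_ideal k G,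
    forall p q J m, node_at t p q J -> relevant_from p q ->
      minimal_generator J m -> m \in monomials R &
    forall p q1 q2 J1 J2 m, node_at t p q1 J1 -> node_at t p q2 J2 ->
      relevant_from p q1 -> relevant_from p q2 ->
      minimal_generator J1 m -> minimal_generator J2 m -> q1 = q2].
Proof.
elim=> [/eqP//|m {}G L RG RL mG aG eqL treeL IHL treeG IHG mRL mRG dis _].
have [G0|[S GS]] := set_0Vmem G.
  exists (Leaf (family_ideal k (m |: G))); split=> //.
  - exists (mesym1 m); have := antichain_minimal_generators k aG.
    rewrite (_ : monomials _ = [fset mesym1 m]%fset) //.
    apply/fsetP=> x; rewrite inE; apply/monomialsP/eqP => [[S]|->].
      by rewrite G0 !inE orbF => /eqP->.
    by exists m; rewrite ?setU11.
  - move=> p q J x [_ ->] _ /(minimal_generatorE _ _ aG)/monomialsP[S].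
    rewrite G0 !inE orbF => /eqP-> ->; rewrite mem_monomials; exact: setU11.
  - by move=> p q1 q2 J1 J2 x [-> _] [-> _].
have nG : G != set0 by apply/set0Pn; exists S.
have nL : L != set0.
  have: above L (m :|: S).
    by rewrite eqL subsetUl; apply/aboveP; exists S => //; apply: subsetUr.
  by apply: contraTneq => ->; rewrite above0.
have [l [tl rl genl uniql]] := IHL nL.
have [r [tr rr genr uniqr]] := IHG nG.
have aG' := pivot_tree_antichain treeG.
have monoD1 : (monomials (m |: G) `\ mesym1 m)%fset = monomials G.
  apply/fsetP=> x; rewrite !inE; apply/andP/monomialsP.
    case=> xm /monomialsP[T]; rewrite !inE => GT eqx; exists T => //.
    by case/orP: GT => // /eqP eqT; rewrite eqx eqT eqxx in xm.
  case=> T GT ->; rewrite mem_monomials !inE GT orbT; split=> //.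
  by apply: contraNneq mG => /inj_mesym1 <-.
have dis_mon x : x \in monomials RL -> x \in monomials RG -> False.
  case/monomialsP=> T RLT ->; rewrite mem_monomials => RGT.
  by rewrite (disjointFr dis RLT) in RGT.
have root_gen p q J x : minimal_generator (family_ideal k (m |: G)) x ->
    node_at l p.*2 q J \/ node_at r p.*2.+1 q J ->
    minimal_generator J x -> ~~ odd q -> False.
  move=> /(minimal_generatorE _ _ aG)/monomialsP[T]; rewrite !inE.
  move=> GT -> nodeJ genJ evq.
  have crl p' : relevant_from p' q by rewrite /relevant_from evq orbT.
  case/predU1P: GT => [eqT|GT].
    rewrite eqT in genJ.
    case: nodeJ => [/genl|/genr] /(_ _ (crl _) genJ);
      by rewrite mem_monomials ?(negbTE mRL) ?(negbTE mRG).
  have RGT : mesym1 T \in monomials RG.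
    by rewrite mem_monomials (subsetP (generators_sub_pivots treeG)).
  case: nodeJ => nodeJ.
    exact: dis_mon (genl _ _ _ _ nodeJ (crl _) genJ) RGT.
  have genT : minimal_generator (root_ideal r) (mesym1 T).
    by rewrite rr; apply/(minimal_generatorE _ _ aG'); rewrite mem_monomials.
  have eqq : q = p.*2.+1.
    apply: (uniqr _ _ _ _ _ _ nodeJ (node_at_root r _)) genJ genT => //.
    by rewrite /relevant_from eqxx.
  by rewrite eqq /= odd_double in evq.
(* Positions grow downwards, so a node other than the root is relevant only by
   being even. *)
have parity p q J : relevant_from p q ->
    node_at (Node (family_ideal k (m |: G)) l r) p q J ->
    (q = p /\ J = family_ideal k (m |: G)) \/
    (~~ odd q /\ (node_at l p.*2 q J \/ node_at r p.*2.+1 q J)).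
  case/orP=> [/eqP-> /=|evq /=].
    case=> [[_ ->]|nodeJ|/node_at_ge]; first by left.
      have := node_at_ge nodeJ; rewrite -addnn -{3}[p]addn0 leq_add2l leqn0.
      (* Position 0 is its own double. *)
      by move/eqP=> p0; right; rewrite p0 in nodeJ *; split=> //; left.
    by rewrite ltnNge -addnn leq_addr.
  by case=> [[-> ->]|nodeJ|nodeJ]; [left|right; split=> //..]; tauto.
exists (Node (family_ideal k (m |: G)) l r); split=> //.
- split=> //; exists (monomials (m |: G)), (mesym1 m).
  rewrite monoD1 rl rr; split=> //.
  + exact: antichain_minimal_generators.
  + rewrite (cardfsD1 (mesym1 m)) mem_monomials setU11 monoD1 ltnS cardfs_gt0.
    by apply/fset0Pn; exists (mesym1 S); rewrite mem_monomials.
  + by rewrite mem_monomials setU11.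
  + move=> p; split.
      move/mem_family_ideal=> gen; split.
        by apply/mem_family_ideal=> x /gen; rewrite eqL => /andP[].
      apply/mem_monomial_ideal=> x /gen; rewrite eqL => /andP[mx _].
      by exists (mesym1 m); rewrite ?inE // mesym1_le.
    case=> /mem_family_ideal genG /mem_monomial_ideal genm.
    apply/mem_family_ideal=> x px; rewrite eqL genG // andbT.
    by have [g] := genm x px; rewrite inE => /eqP->; rewrite mesym1_le.
- move=> p q J x nodeJ crq genJ.
  case: (parity _ _ _ crq nodeJ) => [[_ eqJ]|[evq]].
    rewrite eqJ in genJ.
    have /monomialsP[T GT ->] := iffLR (minimal_generatorE _ _ aG) genJ.
    rewrite mem_monomials; apply: subsetP GT; apply: setUS.
    by apply: subset_trans (generators_sub_pivots treeG) (subsetUr _ _).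
  have crl p' : relevant_from p' q by rewrite /relevant_from evq orbT.
  case=> [/genl|/genr] => /(_ _ (crl _) genJ) /monomialsP[T RT ->];
    by rewrite mem_monomials !inE RT ?orbT.
move=> p q1 q2 J1 J2 x node1 node2 cr1 cr2 gen1 gen2.
case: (parity _ _ _ cr1 node1) => [[eq1 eqJ1]|[ev1 child1]];
  case: (parity _ _ _ cr2 node2) => [[eq2 eqJ2]|[ev2 child2]].
- by rewrite eq1 eq2.
- by rewrite eqJ1 in gen1; case: (root_gen _ _ _ _ gen1 child2 gen2 ev2).
- by rewrite eqJ2 in gen2; case: (root_gen _ _ _ _ gen2 child1 gen1 ev1).
have crl1 p' : relevant_from p' q1 by rewrite /relevant_from ev1 orbT.
have crl2 p' : relevant_from p' q2 by rewrite /relevant_from ev2 orbT.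
case: child1 child2 => [n1|n1] [n2|n2].
- exact: uniql n1 n2 _ _ gen1 gen2.
- by case: (dis_mon x); [apply: genl n1 _ gen1 | apply: genr n2 _ gen2].
- by case: (dis_mon x); [apply: genl n2 _ gen2 | apply: genr n1 _ gen1].
- exact: uniqr n1 n2 _ _ gen1 gen2.
Qed.

Lemma network_idealE (k : fieldType) n (N : network n) :
  same_ideal (family_ideal k (minimal_cuts N)) (network_ideal k N).
Proof.
have prodX (S : {set 'I_n}) :
    (\prod_(s in S) 'X_s)%R = 'X_[mesym1 S] :> {mpoly k[n]}.
  rewrite mprodXE; congr mpolyX; apply/mnmP=> i.
  rewrite mnm_sumE mnmE; under eq_bigr => j _ do rewrite mnm1E.
  have [iS|niS] := boolP (i \in S).
    by rewrite (bigD1 i) //= eqxx big1 // => j /andP[_ /negbTE->].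
  by rewrite big1 // => j jS; case: eqP => // eqji; rewrite -eqji jS in niS.
move=> p; split=> -[s [sG ->]]; exists s; split=> // c /sG.
  case=> _ /monomialsP[S cutS ->] ->; rewrite inE in cutS.
  by exists S; rewrite ?prodX.
by case=> S cutS ->; exists (mesym1 S); rewrite ?prodX // mem_monomials inE.
Qed.

Theorem proposition4p3p12 (k : fieldType) (char_k : [pchar k]%R =i pred0)
    (n : nat) (N : network n) (spN : series_parallel N) :
  mv_type_A (network_ideal k N).
Proof.
have [R treeR] := minimal_cuts_pivot_tree spN.
have [t [treet roott _ uniqt]] :=
  pivot_tree_mv_tree k treeR (minimal_cuts_neq0 N).
exists t; first by split=> //; rewrite roott; apply: network_idealE.
by move=> q1 q2 J1 J2 m; apply: uniqt.
Qed.
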